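(* Let $q=2^m$, let $t\ge 2$, and let $H\subset K=AG(2,q)$ be a star-set (with parameter $t$). Let $$D=\{\,iq+k-i \mid 1\le k\le q-2,\ 0\le i\le \lfloor (k-1)/2\rfloor,\ i\preceq k\,\}.$$ Then $H$ is a KM-arc of type $t$ with $t$-nucleus at $0$ if and only if $$\pi_d(H):=\sum_{y\in H}y^d=0\quad\text{for all } d\in D.$$
   Context: Let $q=2^m$ ($m\ge1$), $F=\mathbb{F}_q$, $K=\mathbb{F}_{q^2}\supset F$. For $x\in K$ put $\bar x=x^q$. Let $S=\{u\in K\mid u\bar u=1\}$ and $\langle x,y\rangle=x\bar y+\bar x y\in F$ for $x,y\in K$. The projective plane $PG(2,q)$ is represented as follows: points are pairs $(x:z)$ with $x\in K$, $z\in F$, $(x,z)\neq(0,0)$, up to multiplication by $F^*$; lines are $[\alpha:\beta]=\{(x:z)\mid \langle\alpha,x\rangle+\beta z=0\}$ with $\alpha\in K$, $\beta\in F$, $(\alpha,\beta)\ne(0,0)$. The line at infinity is $[0:1]$. The affine plane $AG(2,q)=PG(2,q)\setminus[0:1]$ is identified with $K$ via $(x:1)\leftrightarrow x$; its lines are $\{x\in K\mid\langle u,x\rangle+\mu=0\}$ with $u\in S$, $\mu\in F$. A KM-arc of type $t$ in $PG(2,q)$ is a set of $q+t$ points meeting every line in $0$, $2$ or $t$ points. A $t$-secant is a line meeting it in exactly $t$ points. For $2<t<q$ it is known that all $t$-secants of a KM-arc of type $t$ pass through one common point, called its $t$-nucleus. For $t=2$ any point not on $H$ is regarded as a $2$-nucleus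 of $H$. Star-set: for $t\ge2$, a set $H$ of $q+t$ points of $K=AG(2,q)$ is a star-set if all points of $H$ belong to a union of $\frac{q}{t}+1$ lines concurrent at $0$ (in particular $t\mid q$), and each of these lines contains $t$ points of $H$. Partial order $\preceq$ on nonnegative integers: $x\preceq y$ if and only if every binary digit of $x$ is at most the corresponding binary digit of $y$. *)

(* Defs.v *)
From mathcomp Require Import all_boot all_order all_algebra all_field.

Set Implicit Arguments.
Unset Strict Implicit.
Unset Printing Implicit Defensive.

Import GRing.Theory.
Local Open Scope ring_scope.

(* Throughout, [K] is meant to be the field with [q ^ 2] elements. *)

Definition conjq (K : finFieldType) (q : nat) (x : K) : K := x ^+ q.

(* The subfield of order [q] of [K], realized as the fixed field of
   [x |-> x ^+ q]; see [Fq_divring_closed] and [card_Fq]. *)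
Definition Fq (K : finFieldType) (q : nat) : {set K} :=
  [set x | conjq q x == x].

Definition unit_circle (K : finFieldType) (q : nat) : {set K} :=
  [set u | u * conjq q u == 1].

Definition bform (K : finFieldType) (q : nat) (x y : K) : K :=
  x * conjq q y + conjq q x * y.

(* Homogeneous coordinates, both of points (x : z) and of lines
   [alpha : beta]. *)
Definition hcoords (K : finFieldType) (q : nat) : {set K * K} :=
  [set v | (v.2 \in Fq K q) && (v != (0, 0))].

(* A point of PG(2,q) is the class, modulo nonzero scalars of the subfield,
   of a vector of homogeneous coordinates. *)
Definition pg_point (K : finFieldType) (q : nat) (v : K * K) : {set K * K} :=
  [set (c * v.1, c * v.2) | c in Fq K q :\ 0].

Definition pg_points (K : finFieldType) (q : nat) : {set {set K * K}} :=
  [set pg_point q v | v in hcoords K q].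

(* The incidence equation is homogeneous, so quantifying over all
   representatives of [P] amounts to testing one of them. *)
Definition pg_line (K : finFieldType) (q : nat) (a : K * K) :
    {set {set K * K}} :=
  [set P in pg_points K q |
    [forall v in P, bform q a.1 v.1 + a.2 * v.2 == 0]].

Definition pg_lines (K : finFieldType) (q : nat) : {set {set {set K * K}}} :=
  [set pg_line q a | a in hcoords K q].

(* The identification of K with the affine plane AG(2,q). *)
Definition affine_point (K : finFieldType) (q : nat) (x : K) : {set K * K} :=
  pg_point q (x, 1).

Definition affine_set (K : finFieldType) (q : nat) (H : {set K}) :
    {set {set K * K}} :=
  [set affine_point q x | x in H].

Definition affine_line (K : finFieldType) (q : nat) (u mu : K) : {set K} :=
  [set x | bform q u x + mu == 0].

Definition affine_lines (K : finFieldType) (q : nat) : {set {set K}} :=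
  [set affine_line q u mu | u in unit_circle K q, mu in Fq K q].

Definition is_KM_arc (K : finFieldType) (q t : nat) (A : {set {set K * K}}) :
    Prop :=
  [/\ A \subset pg_points K q,
      #|A| = (q + t)%N
    & forall l, l \in pg_lines K q ->
        [\/ #|A :&: l| = 0%N, #|A :&: l| = 2 | #|A :&: l| = t]].

Definition is_secant (K : finFieldType) (q t : nat)
    (A l : {set {set K * K}}) : Prop :=
  l \in pg_lines K q /\ #|A :&: l| = t.

(* For [t = 2], by convention, every point off the arc is a 2-nucleus. *)
Definition is_nucleus (K : finFieldType) (q t : nat) (A : {set {set K * K}})
    (N : {set K * K}) : Prop :=
  N \in pg_points K q /\
  (if t == 2 then N \notin A : Prop
   else forall l, is_secant q t A l -> N \in l).

Definition is_star_set (K : finFieldType) (q t : nat) (H : {set K}) : Prop :=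
  [/\ #|H| = (q + t)%N,
      (t %| q)%N
    & exists L : {set {set K}},
        [/\ #|L| = (q %/ t + 1)%N,
            forall l, l \in L ->
              [/\ l \in affine_lines K q, 0 \in l & #|H :&: l| = t]
          & H \subset cover L]].

Definition bin_digit (x j : nat) : nat := (x %/ 2 ^ j) %% 2.

Definition digit_le (x y : nat) : Prop :=
  forall j, (bin_digit x j <= bin_digit y j)%N.

Definition exponent_set (q d : nat) : Prop :=
  exists k i : nat,
    [/\ (1 <= k <= q - 2)%N, (i <= (k - 1) %/ 2)%N, digit_le i k
      & d = (i * q + k - i)%N].

Definition power_sum (K : finFieldType) (d : nat) (H : {set K}) : K :=
  \sum_(y in H) y ^+ d.

Section FixedField.

Variables (m q : nat) (K : finFieldType).
Hypotheses (m_gt0 : (1 <= m)%N) (def_q : q = (2 ^ m)%N).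
Hypothesis card_K : #|K| = (q ^ 2)%N.

Lemma char2_of_card : 2%N \in [pchar K].
Proof.
by apply: (@card_finPcharP _ _ (m * 2)); rewrite // card_K def_q expnM.
Qed.

Lemma exprBq (R : comNzRingType) (x y : R) :
  2%N \in [pchar R] -> (x - y) ^+ q = x ^+ q - y ^+ q.
Proof.
move=> ch2; rewrite !(oppr_pchar2 ch2) exprDn_pchar // def_q.
by rewrite pnatX pnatE // ch2.
Qed.

Lemma Fq_divring_closed : divring_closed (Fq K q).
Proof.
split=> [|x y|x y]; rewrite !inE.
- by rewrite /conjq expr1n.
- by rewrite /conjq => /eqP Ex /eqP Ey; rewrite exprBq ?char2_of_card // Ex Ey.
- by rewrite /conjq expr_div_n => /eqP -> /eqP ->.
Qed.

Lemma card_Fq : #|Fq K q| = q.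
Proof.
have q_gt1 : (1 < q)%N by rewrite def_q -{1}(expn0 2) ltn_exp2l.
have sz : size ('X^q - 'X : {poly K}) = q.+1.
  by rewrite size_polyDl ?size_polyXn // size_polyN size_polyX.
have dvd : ('X^q - 'X : {poly K}) %| \prod_x ('X - x%:P).
  rewrite -finField_genPoly card_K expnS expn1 exprM.
  have -> : 'X^q ^+ q - 'X = ('X^q - 'X : {poly K}) ^+ q + ('X^q - 'X).
    by rewrite exprBq ?pchar_poly ?char2_of_card // addrA subrK.
  by apply: dvdp_add => //; apply: dvdp_exp => //; apply: ltnW.
have [r eqr] := dvdp_prod_XsubC dvd.
set s := mask r _ in eqr.
have us : uniq s by rewrite mask_uniq // index_enum_uniq.
have := eqp_size eqr; rewrite sz size_prod_XsubC => -[eq_q].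
rewrite [RHS]eq_q -(card_uniqP us); apply: eq_card => x.
rewrite inE -[x \in s]root_prod_XsubC -(eqp_root eqr) rootE !hornerE ?hornerXn.
by rewrite /conjq subr_eq0.
Qed.

End FixedField.

(* Main.v *)
Require Import Defs.
From mathcomp Require Import all_boot all_order all_algebra all_field.
From mathcomp Require Import ring.

(** The proof turns the incidence condition into a parity condition and reads
    off the parity condition from the coefficients of two polynomials.

    For a star-set [H], the lines through 0 meet [H] in 0 or [t] points, and
    [t], like [q], is a power of 2. If all lines meet [H] in an even number of
    points, then so do the [q] lines that join a point [P] of [H] to the points
    other than 0; each of them contains [P], hence another point of [H], and
    there are only [q] points of [H] off the line through 0 and [P], so each of
    them contains exactly one ([even_sections_two]). Thus [H] is a KM-arc with
    nucleus 0 if and only if all its line sections are even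
    ([KM_arc_iff_even]).

    As [c ^+ (q - 1)] is 0 or 1 according to whether [c] in the subfield is
    zero, the size of the section by [<a, y> + b = 0] is, in characteristic 2
    and for [#|H|] even, the sum of [(<a, y> + b) ^+ (q - 1)] over [H]. This is
    a polynomial in [b] of degree less than [q] that vanishes on a field with
    [q] elements, so its coefficients, which are the sums of [<a, y> ^+ k],
    vanish ([even_sections_iff_forms]). The extreme cases [k = 0] and
    [k = q - 1] hold for every star-set: they express the evenness of [#|H|]
    and of the sections through 0.

    Finally [<a, y> ^+ k] expands into the monomials [a ^+ (i + q * (k - i))],
    with coefficients ['C(k, i)] times a power of [y]. Their exponents are
    distinct and less than [q ^ 2], so that, when [a] runs over the whole field,
    the power sums with ['C(k, i)] odd vanish ([forms_eq0_iff]). The condition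
    on ['C(k, i)] is the digit condition by Lucas' theorem ([odd_binP]), and
    [i] may be restricted to the lower half of [0..k] because exchanging [i]
    and [k - i] conjugates the power sum ([half_range_iff]). *)

Set Implicit Arguments.
Unset Strict Implicit.
Unset Printing Implicit Defensive.

Import GRing.Theory.
Local Open Scope ring_scope.

(** * Binomial coefficients modulo 2 *)

(** Modulo 2, [(1 + X) ^ 2n] is the polynomial [(1 + X ^ 2) ^ n]. *)
Lemma odd_bin_double n k :
  (odd 'C(n.*2, k.*2) = odd 'C(n, k)) * (odd 'C(n.*2, k.*2.+1) = false).
Proof.
elim: n k => [|n IHn] [|k].
- by rewrite !double0.
- by rewrite doubleS !bin0n.
- by rewrite double0 !bin0 bin1 odd_double.
rewrite !doubleS !binS -!doubleS !oddD !IHn.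
by rewrite !addbF !addFb addbb.
Qed.

Lemma odd_bin_halves n k :
  odd 'C(n, k) = (odd k ==> odd n) && odd 'C(n./2, k./2).
Proof.
rewrite -{1}(odd_double_half n) -{1}(odd_double_half k).
case: (odd n); case: (odd k);
  rewrite ?add0n ?add1n ?binS ?oddD ?odd_bin_double //=.
case: (k./2) => [|j]; first by rewrite !bin0.
by rewrite doubleS binS oddD -doubleS !odd_bin_double addbF.
Qed.

Lemma bin_digit0 x : bin_digit x 0 = odd x.
Proof. by rewrite /bin_digit divn1 modn2. Qed.

Lemma bin_digitS x j : bin_digit x j.+1 = bin_digit x./2 j.
Proof. by rewrite /bin_digit expnS divnMA divn2. Qed.

(** Lucas' theorem for the prime 2. *)
Lemma odd_binP n k : reflect (digit_le k n) (odd 'C(n, k)).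
Proof.
suff E : odd 'C(n, k) <-> digit_le k n.
  by apply: (iffP idP) => /E.
elim/ltn_ind: k n => -[|k] IHk n.
  by rewrite bin0; split=> // _ j; rewrite /bin_digit div0n mod0n.
have /IHk/(_ n./2) E : (k.+1./2 < k.+1)%N.
  by rewrite ltn_half_double -addnn -{1}[k.+1]addn0 ltn_add2l.
rewrite odd_bin_halves; split=> [/andP[le0 /E le_half] [|j]|le_kn].
- by rewrite !bin_digit0; case: (odd k.+1) le0 => //= ->.
- by rewrite !bin_digitS.
apply/andP; split; last by apply/E => j; rewrite -!bin_digitS.
by have := le_kn 0%N; rewrite !bin_digit0; do 2!case: (odd _).
Qed.

(** The two terms of Pascal's rule for a central coefficient are symmetric. *)
Lemma odd_central_bin i : (0 < i)%N -> odd 'C(i.*2, i) = false.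
Proof.
case: i => // i _; rewrite doubleS binS -(@bin_sub i.*2.+1 i); last first.
  by rewrite -addnn leqW // leq_addr.
by rewrite -addnn subSn ?leq_addr // addnK addnn odd_double.
Qed.

(** All ['C(n, i)] are odd when [n.+1] is a power of 2. The proof avoids them:
    multiplied by [x + y], both sides are [x ^+ n.+1 + y ^+ n.+1]. *)
Lemma exprD_pchar2_geom (R : idomainType) m n (x y : R) :
  2%N \in [pchar R] -> (0 < m)%N -> n.+1 = (2 ^ m)%N ->
  (x + y) ^+ n = \sum_(i < n.+1) x ^+ (n - i) * y ^+ i.
Proof.
move=> ch2 m_gt0 Dn.
have [Dxy | nz_xy] := eqVneq (x + y) 0.
  (* The right-hand side then consists of [n.+1] equal terms, and [n.+1] is
     even. *)
  have -> : y = x.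
    by apply/esym/eqP; rewrite -(oppr_pchar2 ch2 y) -addr_eq0 Dxy.
  have n_gt0 : (0 < n)%N by rewrite -ltnS Dn -{1}(expn0 2) ltn_exp2l.
  rewrite addrr_pchar2 // expr0n -[n == 0%N]negbK -lt0n n_gt0.
  under eq_bigr => i _ do rewrite -exprD subnK ?leq_ord //.
  rewrite sumr_const card_ord Dn -(prednK m_gt0) expnS mulrnA mulr2n.
  by rewrite addrr_pchar2 // mul0rn.
apply: (mulfI nz_xy); rewrite -exprS exprDn_pchar; last first.
  by rewrite Dn pnatX pnatE // ch2.
by rewrite -(oppr_pchar2 ch2 (y ^+ _)) subrXX oppr_pchar2.
Qed.

(** * The quadratic extension and its trace form *)

Section QuadraticExtension.

Variables (m q : nat) (K : finFieldType).
Hypotheses (m_ge1 : (1 <= m)%N) (def_q : q = (2 ^ m)%N).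
Hypothesis card_K : #|K| = (q ^ 2)%N.

Implicit Types (a b c x y : K) (H : {set K}).

Let ch2 : 2%N \in [pchar K] := char2_of_card def_q card_K.

Lemma q_gt1 : (1 < q)%N.
Proof. by rewrite def_q -{1}(expn0 2) ltn_exp2l. Qed.

Lemma q_gt0 : (0 < q)%N. Proof. exact: ltnW q_gt1. Qed.

Lemma q_even : ~~ odd q.
Proof. by rewrite def_q oddX negb_or -lt0n m_ge1. Qed.

Lemma eq_pchar2 x y : (x + y == 0) = (x == y).
Proof. by rewrite -{1}(oppr_pchar2 ch2 y) subr_eq0. Qed.

Lemma conjq0 : conjq q (0 : K) = 0.
Proof. by rewrite /conjq expr0n gtn_eqF ?q_gt0. Qed.

Lemma conjqD : {morph @conjq K q : x y / x + y}.
Proof.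
move=> x y; rewrite -{1}(oppr_pchar2 ch2 y) /conjq (exprBq def_q) //.
by rewrite oppr_pchar2.
Qed.

Lemma conjqM : {morph @conjq K q : x y / x * y}.
Proof. by move=> x y; apply: exprMn. Qed.

Lemma conjqK : involutive (@conjq K q).
Proof. by move=> x; rewrite /conjq -exprM mulnn -card_K expf_card. Qed.

Lemma FqP c : reflect (conjq q c = c) (c \in Fq K q).
Proof. by rewrite inE; apply: eqP. Qed.

Lemma bform_Fq a x : bform q a x \in Fq K q.
Proof.
by apply/FqP; rewrite /bform conjqD !conjqM !conjqK addrC.
Qed.

Lemma bformDr a x y : bform q a (x + y) = bform q a x + bform q a y.
Proof. by rewrite /bform conjqD !mulrDr addrACA. Qed.

Lemma bformZr a c x : c \in Fq K q -> bform q a (c * x) = c * bform q a x.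
Proof.
by move/FqP=> Ec; rewrite /bform conjqM Ec mulrDr !(mulrCA c).
Qed.

Lemma bform0l x : bform q 0 x = 0.
Proof. by rewrite /bform conjq0 !mul0r addr0. Qed.

Lemma bform0r a : bform q a 0 = 0.
Proof. by rewrite /bform conjq0 !mulr0 addr0. Qed.

(** The vectors orthogonal to [y] form the line [Fq * y]: in characteristic 2
    the equation says that [a / y] equals its conjugate. *)
Lemma bform_eq0 a y : y != 0 -> (bform q a y == 0) = (a / y \in Fq K q).
Proof.
move=> nz_y; rewrite inE /bform eq_pchar2 /conjq expr_div_n eq_sym.
by rewrite eqr_div ?expf_neq0.
Qed.

Lemma card_bform_eq0 y :
  y != 0 -> #|[set a | (a != 0) && (bform q a y == 0)]| = q.-1.
Proof.
move=> nz_y; have F0 : 0 \in Fq K q.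
  exact/FqP/conjq0.
have <- : #|Fq K q :\ 0| = q.-1.
  have := card_Fq m_ge1 def_q card_K; rewrite (cardsD1 0) F0.
  by move/(canRL (addKn _)); rewrite subn1.
rewrite -(card_imset _ (mulIf nz_y)); apply: eq_card => a; rewrite inE.
rewrite bform_eq0 //; apply/idP/imsetP=> [/andP[nz_a Fa]|[c]].
  by exists (a / y); rewrite ?divfK // in_setD1 Fa mulf_neq0 ?invr_eq0.
by rewrite in_setD1 => /andP[nz_c Fc] ->; rewrite mulf_neq0 ?mulfK.
Qed.

(** * Sections of a point set by lines *)

Definition line_section H a b : {set K} := [set y in H | bform q a y + b == 0].

Lemma mem_affine_point x : affine_point q x \in pg_points K q.
Proof.
apply/imsetP; exists (x, 1) => //.
by rewrite inE /= xpair_eqE oner_eq0 andbF andbT inE /conjq expr1n.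
Qed.

Lemma affine_point_inj : injective (@affine_point K q).
Proof.
move=> x y Exy.
have : (x, 1) \in affine_point q x.
  apply/imsetP; exists 1; rewrite ?mul1r // in_setD1 oner_eq0.
  by apply/FqP; rewrite /conjq expr1n.
by rewrite Exy => /imsetP[c _ [-> /esym]]; rewrite mulr1 => ->; rewrite mul1r.
Qed.

Lemma mem_pg_line a b x :
  (affine_point q x \in pg_line q (a, b)) = (bform q a x + b == 0).
Proof.
have F1 : 1 \in Fq K q by apply/FqP; rewrite /conjq expr1n.
rewrite inE mem_affine_point /=.
apply/forall_inP/idP=> [/(_ (x, 1))|/eqP on_ax v /imsetP[c]].
  rewrite /= mulr1; apply; apply/imsetP.
  by exists 1; rewrite ?mul1r // in_setD1 oner_eq0 F1.
rewrite in_setD1 => /andP[_ Fc] -> /=.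
by rewrite mulr1 bformZr // [b * c]mulrC -mulrDr on_ax mulr0.
Qed.

Lemma card_line_section H a b :
  #|affine_set q H :&: pg_line q (a, b)| = #|line_section H a b|.
Proof.
rewrite -(card_imset _ affine_point_inj); apply: eq_card => P; rewrite inE.
apply/andP/imsetP=> [[/imsetP[x Hx ->]]|[x]].
  by rewrite mem_pg_line => ax; exists x; rewrite // inE Hx.
by rewrite inE => /andP[Hx ax] ->; rewrite imset_f ?mem_pg_line.
Qed.

(** Lines through [P] are counted by their vectors [a']: every point other than
    [P] lies on the lines of exactly [q - 1] vectors [a'], so the numbers of
    further points of [H] on these lines add up to [(q + t - 1) * (q - 1)]. The vectors
    of the line through 0 account for [(t - 1) * (q - 1)] of that, which leaves
    [q * (q - 1)] for the same number of remaining vectors, while each of them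
    contributes at least 1 by parity. *)
Lemma even_sections_two H t a b P :
    (0 < t)%N -> #|H| = (q + t)%N ->
    (forall a' y, a' != 0 -> y \in H -> y != 0 -> bform q a' y = 0 ->
      #|line_section H a' 0| = t) ->
    (forall a' b', b' \in Fq K q -> ~~ odd #|line_section H a' b'|) ->
  b != 0 -> P \in line_section H a b -> #|line_section H a b| = 2.
Proof.
move=> t_gt0 card_H radial even nz_b.
rewrite inE eq_pchar2 => /andP[HP /eqP Db].
have nz_a : a != 0 by apply: contra_neq nz_b => a0; rewrite -Db a0 bform0l.
have nz_P : P != 0 by apply: contra_neq nz_b => P0; rewrite -Db P0 bform0r.
pose others a' := line_section H a' (bform q a' P) :\ P.
have cardS a' : #|line_section H a' (bform q a' P)| = #|others a'|.+1.
  by rewrite (cardsD1 P) inE HP addrr_pchar2 // eqxx.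
have sum_others : (\sum_(a' | a' != 0%R) #|others a'| = (q + t).-1 * q.-1)%N.
  transitivity (\sum_(a' | a' != 0%R)
      \sum_(Q in H :\ P | bform q a' (Q + P)%R == 0%R) 1)%N.
    apply: eq_bigr => a' _; rewrite -sum1_card; apply: eq_bigl => Q.
    by rewrite !inE -andbA bformDr.
  rewrite (exchange_big_dep (fun Q => Q \in H :\ P)) /=; last first.
    by move=> ? ? _ /andP[].
  rewrite -card_H (cardsD1 P H) HP /= -sum_nat_const.
  apply: eq_bigr => Q; rewrite in_setD1 => /andP[nPQ HQ].
  rewrite -(@card_bform_eq0 (Q + P)) ?eq_pchar2 // -sum1dep_card.
  by apply: eq_bigl => a'; rewrite nPQ HQ.
have sum_radial : (\sum_(a' | (a' != 0%R) && (bform q a' P == 0%R)) #|others a'|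
                   = q.-1 * t.-1)%N.
  rewrite -(card_bform_eq0 nz_P) -sum1dep_card big_distrl /=.
  apply: eq_bigr => a' /andP[nz_a' /eqP a'P].
  by rewrite mul1n -(radial a' P) // -a'P cardS.
have card_other :
    (#|[set a' | (a' != 0%R) && (bform q a' P != 0%R)]| = q.-1 * q)%N.
  have : (\sum_(a' : K | a' != 0%R) 1 = (q ^ 2).-1)%N.
    by rewrite -card_K -(cardC1 (0 : K)) -sum1_card; apply: eq_bigl.
  rewrite (bigID (fun a' => bform q a' P == 0)) /=.
  rewrite !sum1dep_card card_bform_eq0 //.
  move/(canRL (addKn _)) => ->.
  by case: (q) q_gt0 => // n _; rewrite -mulnn mulSn /= addKn.
have gt0 a' : a' != 0 -> (0 < #|others a'|)%N.
  move=> nz_a'; have := even a' _ (bform_Fq a' P).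
  by rewrite cardS; case: #|_|.
have [_] := @leqif_sum _ (fun a' => (a' != 0) && (bform q a' P != 0))
   _ (fun=> 1%N) (fun a' => #|others a'|)
   (fun a' Pa' => leqif_eq (gt0 a' (proj1 (andP Pa')))).
rewrite sum1dep_card card_other.
have -> : (\sum_(a' | (a' != 0%R) && (bform q a' P != 0%R)) #|others a'|
           = q.-1 * q)%N.
  move: sum_others; rewrite (bigID (fun a' => bform q a' P == 0)) /= sum_radial.
  move/(canRL (addKn _)) => ->.
  by rewrite mulnC -mulnBr -[in (q + t).-1](prednK t_gt0) addnS /= addnK.
rewrite eqxx => /esym/forall_inP/(_ a).
by rewrite nz_a Db nz_b => /(_ isT)/eqP; rewrite -Db cardS => <-.
Qed.

(** * Star-sets *)

Section StarSet.

Variables (t : nat) (H : {set K}).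
Hypotheses (t_ge2 : (2 <= t)%N) (star_H : is_star_set q t H).

Let card_H : #|H| = (q + t)%N. Proof. by case: star_H. Qed.

Lemma star_mult_even : ~~ odd t.
Proof.
have [_ + _] := star_H; rewrite def_q => /dvdn_pfactor[//|e _ Dt].
by move: t_ge2; rewrite Dt oddX; case: e {Dt}.
Qed.

(** If 0 were in [H], each of the [q / t + 1] lines would contribute only
    [t - 1] further points, too few for a set of [q + t] points. *)
Lemma star_set_notin0 : 0 \notin H.
Proof.
have [_ dvd_t_q [L [card_L Lprops sub_HL]]] := star_H.
apply/negP => H0.
have t_gt0 := ltnW t_ge2.
have : (#|H :\ 0%R| <= \sum_(l in L) t.-1)%N.
  rewrite -sum1_card.
  apply: (@leq_trans (\sum_(y in H :\ 0%R) \sum_(l in L | y \in l) 1)%N).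
    apply: leq_sum => y; rewrite in_setD1 => /andP[_ /(subsetP sub_HL)].
    by case/bigcupP=> l Ll ly; rewrite (bigD1 l) ?Ll ?ly.
  rewrite (exchange_big_dep (mem L)) /=; last by move=> ? ? _ /andP[].
  apply: leq_sum => l Ll; have [_ l0 <-] := Lprops l Ll.
  rewrite (cardsD1 0) inE H0 l0 /= -sum1_card eq_leq //; apply: eq_bigl => y.
  by rewrite !inE Ll /= andbA.
have := cardsD1 0 H; rewrite H0 card_H sum_nat_const card_L.
rewrite add1n => /(congr1 predn) /= <-.
rewrite -{1}(divnK dvd_t_q) -{2 3}(prednK t_gt0) addnS /= mulnS mulnDl mul1n.
rewrite -addnA -[X in (_ <= X)%N]add0n leq_add2r leqn0.
by rewrite -leqn0 leqNgt divn_gt0 // dvdn_leq ?q_gt0.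
Qed.

(** The line of the star that contains [y] is the only line through 0 and [y],
    so it is the one defined by [a]. *)
Lemma card_radial_section a y :
  a != 0 -> y \in H -> bform q a y = 0 -> #|line_section H a 0| = t.
Proof.
move=> nz_a Hy ay0.
have nz_y : y != 0 by apply: contraTneq Hy => ->; apply: star_set_notin0.
have [_ _ [L [_ Lprops /subsetP/(_ y Hy)/bigcupP[l Ll ly]]]] := star_H.
have [/imset2P[u mu uS _ Dl] l0 <-] := Lprops l Ll.
move: l0 ly; rewrite Dl !inE bform0r add0r => /eqP->; rewrite addr0 => uy0.
have nz_u : u != 0.
  apply: contraTneq uS => ->; rewrite inE mul0r eq_sym; exact: oner_neq0.
congr #|pred_of_set _|; apply/setP => x; rewrite !inE !addr0.
case: (x \in H) => //=.
have [->|nz_x] := eqVneq x 0; first by rewrite !bform0r eqxx.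
move/eqP: ay0; rewrite !bform_eq0 // in uy0 * => ay0.
have [_ _ FV] := Fq_divring_closed def_q card_K.
have ratio b c : b != 0 -> c != 0 -> b / y \in Fq K q -> c / y \in Fq K q ->
    b / x \in Fq K q -> c / x \in Fq K q.
  move=> nz_b nz_c Fb Fc /FV/(_ (FV _ _ Fb Fc)).
  have -> // : b / x / (b / y / (c / y)) = c / x.
  by field; rewrite nz_b nz_c nz_x nz_y.
by apply/idP/idP; apply: ratio.
Qed.

Lemma star_radial_even a : ~~ odd #|line_section H a 0|.
Proof.
have [->|nz_a] := eqVneq a 0.
  have -> : line_section H 0 0 = H.
    by apply/setP => y; rewrite inE bform0l addr0 eqxx andbT.
  by rewrite card_H oddD negb_add (negPf star_mult_even) (negPf q_even).
have [->|[y]] := set_0Vmem (line_section H a 0); first by rewrite cards0.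
rewrite inE addr0 => /andP[Hy /eqP ay].
by rewrite (card_radial_section nz_a Hy ay) star_mult_even.
Qed.

(** The nucleus comes for free from the parity: lines off 0 then meet [H] in 0
    or 2 points, so they are not [t]-secants unless [t = 2]. *)
Lemma KM_arc_iff_even :
  is_KM_arc q t (affine_set q H) /\
    is_nucleus q t (affine_set q H) (affine_point q 0)
  <-> (forall a b, b \in Fq K q -> ~~ odd #|line_section H a b|).
Proof.
have line_a a b : b \in Fq K q -> (a, b) != 0 ->
    pg_line q (a, b) \in pg_lines K q.
  by move=> Fb nz_ab; apply/imsetP; exists (a, b); rewrite // inE Fb.
have t_even := star_mult_even.
split=> [[[_ _ KM] _] a b Fb | even].
  have [[_ ->] | nz_ab] := eqVneq (a, b) 0; first exact: star_radial_even.
  by case: (KM _ (line_a a b Fb nz_ab)); rewrite card_line_section => ->.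
have sec02 a b : b != 0 ->
    #|line_section H a b| = 0%N \/ #|line_section H a b| = 2.
  move=> nz_b; have [->|[P abP]] := set_0Vmem (line_section H a b).
    by left; rewrite cards0.
  right; apply: (even_sections_two (ltnW t_ge2)) abP => //.
  by move=> a' y nz_a' Hy _; apply: card_radial_section.
split; split.
- by apply/subsetP=> _ /imsetP[x _ ->]; apply: mem_affine_point.
- by rewrite card_imset //; apply: affine_point_inj.
- move=> _ /imsetP[[a b] + ->]; rewrite card_line_section inE => /andP[/= _].
  have [-> nz_a|/(sec02 a)[->|->] _] := eqVneq b 0; last 2 first.
  + by constructor 1.
  + by constructor 2.
  have [->|[P]] := set_0Vmem (line_section H a 0).
    by constructor 1; rewrite cards0.
  rewrite inE addr0 => /andP[HP /eqP aP]; constructor 3.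
  by apply: card_radial_section aP => //; apply: contraNneq nz_a => ->.
- exact: mem_affine_point.
case: eqVneq => [t2|nt2].
  apply/imsetP=> -[x Hx /affine_point_inj x0].
  by case/negP: star_set_notin0; rewrite x0.
move=> _ [/imsetP[[a b] _ ->]].
rewrite card_line_section mem_pg_line bform0r add0r.
have [//|/(sec02 a)[->|->] Dt] := eqVneq b 0; first by move: t_ge2; rewrite -Dt.
by rewrite Dt eqxx in nt2.
Qed.

End StarSet.

(** * Even sections and power sums *)

Lemma Fq_exp_pred c : c \in Fq K q -> c ^+ q.-1 = (c != 0)%:R.
Proof.
have [-> _|nz_c /FqP Dc] := eqVneq c 0.
  by rewrite expr0n eqn0Ngt -subn1 subn_gt0 q_gt1.
by apply: (mulfI nz_c); rewrite -exprS prednK ?q_gt0 // mulr1.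
Qed.

Lemma natr_even n : (n%:R == 0 :> K) = ~~ odd n.
Proof. by rewrite -(dvdn_pcharf ch2) dvdn2. Qed.

Lemma sum_form_pow_pred H a b : b \in Fq K q ->
  \sum_(y in H) (bform q a y + b) ^+ q.-1
    = #|H|%:R - #|line_section H a b|%:R.
Proof.
move=> Fb; have Fab y : bform q a y + b \in Fq K q.
  by apply/FqP; rewrite conjqD !(FqP _ _) ?bform_Fq.
have -> : #|line_section H a b|%:R
    = \sum_(y in H) (bform q a y + b == 0)%:R :> K.
  rewrite -sum1_card natr_sum; under eq_bigl do rewrite inE.
  by rewrite big_mkcondr; apply: eq_bigr => y _; case: ifP.
rewrite -sum1_card natr_sum -sumrB; apply: eq_bigr => y _.
by rewrite Fq_exp_pred //; case: eqP; rewrite (subrr, subr0).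
Qed.

(** Both sides say that, for each [a], the polynomial in [b] whose value at [b]
    is the parity of the section vanishes: at the [q] points of the subfield on
    the left, coefficient by coefficient on the right. *)
Lemma even_sections_iff_forms H :
    ~~ odd #|H| -> (forall a, ~~ odd #|line_section H a 0|) ->
  (forall a b, b \in Fq K q -> ~~ odd #|line_section H a b|) <->
  (forall k a, (1 <= k <= q - 2)%N -> \sum_(y in H) bform q a y ^+ k = 0).
Proof.
move=> evenH radial.
have F0 : 0 \in Fq K q.
  exact/FqP/conjq0.
pose c a k := \sum_(y in H) bform q a y ^+ k.
pose p a := \poly_(i < q) c a (q.-1 - i)%N.
have evenE a b : b \in Fq K q -> ~~ odd #|line_section H a b| = root (p a) b.
  move=> Fb; have := sum_form_pow_pred H a Fb.
  have /eqP -> : #|H|%:R == 0 :> K by rewrite natr_even.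
  rewrite sub0r oppr_pchar2 // -natr_even rootE horner_poly => <-.
  congr (_ == 0); under [RHS]eq_bigr do rewrite mulr_suml.
  rewrite exchange_big; apply: eq_bigr => y _.
  by rewrite (exprD_pchar2_geom _ _ ch2 m_ge1) prednK ?q_gt0.
split=> [even k a /andP[k_gt0 le_k] | forms a b Fb].
  have p0 : p a = 0.
    apply: (@roots_geq_poly_eq0 _ _ (enum (Fq K q))); rewrite ?enum_uniq //.
      by apply/allP=> b; rewrite mem_enum => Fb; rewrite -evenE ?even.
    by rewrite -cardE (card_Fq m_ge1 def_q card_K) size_poly.
  have le_kq : (k <= q.-1)%N.
    by rewrite (leq_trans le_k) // -subn1 leq_sub2l.
  have := congr1 (fun r : {poly K} => r`_(q.-1 - k)) p0.
  rewrite /p coef0 coef_poly subKn //.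
  by rewrite (leq_ltn_trans (leq_subr _ _)) // prednK ?q_gt0.
(* The coefficients of exponent 0 and [q - 1], which the range of [k] leaves
   out, vanish by the parity assumptions on [H]. *)
have c0 : c a 0%N = 0.
  by apply/eqP; rewrite /c sumr_const natr_even.
have cq : c a q.-1 = 0.
  have := radial a; rewrite evenE // rootE horner_poly => /eqP <-.
  rewrite -(prednK q_gt0) big_ord_recl expr0 mulr1 subn0 big1 ?addr0 //= => i _.
  by rewrite expr0n mulr0.
rewrite evenE // rootE horner_poly big1 // => i _.
have : (q.-1 - i <= q.-1)%N by rewrite leq_subr.
move: (q.-1 - i)%N => k; rewrite leq_eqVlt => /predU1P[->|lt_k].
  by rewrite cq mul0r.
case: k lt_k => [|k] lt_k; first by rewrite c0 mul0r.
rewrite /c forms ?mul0r //=.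
by rewrite subn2 -ltnS (ltn_predK lt_k).
Qed.

Lemma bform_exp a y k :
  bform q a y ^+ k =
  \sum_(i < k.+1) ('C(k, i)%:R * y ^+ (i * q + k - i)) * a ^+ (i + q * (k - i)).
Proof.
rewrite /bform addrC exprDn; apply: eq_bigr => i _.
rewrite /conjq -mulr_natl -!mulrA; congr (_ * _).
rewrite -addnBA ?leq_ord // !exprMn -!exprM !exprD [(i * q)%N]mulnC.
by rewrite -mulrA; ring.
Qed.

(** For [i <= k < q] the exponents [i + q * (k - i)] are distinct, being
    determined by their residues [i] modulo [q], and they are less than
    [q ^ 2 = #|K|]; so a polynomial in [a] with these exponents vanishes on [K]
    only if its coefficients do. *)
Lemma forms_eq0_iff H k : (k < q)%N ->
  (forall a, \sum_(y in H) bform q a y ^+ k = 0) <->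
  (forall i, (i <= k)%N -> odd 'C(k, i) -> power_sum (i * q + k - i) H = 0).
Proof.
move=> lt_kq.
pose e i := (i + q * (k - i))%N.
pose c i := 'C(k, i)%:R * power_sum (i * q + k - i) H : K.
pose p : {poly K} := \sum_(i < k.+1) c i *: 'X^(e i).
have pE a : \sum_(y in H) bform q a y ^+ k = p.[a].
  under eq_bigr do rewrite bform_exp.
  rewrite exchange_big horner_sum; apply: eq_bigr => i _.
  by rewrite hornerZ hornerXn /c /power_sum mulr_sumr mulr_suml.
have e_inj (i j : 'I_k.+1) : (e i == e j) = (i == j).
  apply/eqP/eqP=> [|-> //] /(congr1 (modn^~ q)).
  rewrite /e !(addnC _ (q * _)%N) !(mulnC q) !modnMDl.
  by rewrite !modn_small ?(leq_ltn_trans (leq_ord _)) // => /ord_inj.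
have coefp (i : 'I_k.+1) : p`_(e i) = c i.
  rewrite coef_sum (bigD1 i) //= coefZ coefXn eqxx mulr1 big1 ?addr0 // => j.
  by rewrite coefZ coefXn e_inj eq_sym => /negPf->; rewrite mulr0.
have size_p : (size p <= #|K|)%N.
  rewrite card_K -mulnn; apply: leq_trans (size_sum _ _ _) _.
  apply/bigmax_leqP=> i _; apply: leq_trans (size_scale_leq _ _) _.
  rewrite size_polyXn /e -(prednK q_gt0) [X in (_ <= X)%N]mulnS -addSn.
  rewrite leq_add //.
    by rewrite prednK ?q_gt0 // (leq_ltn_trans (leq_ord _)).
  rewrite leq_mul2l; apply/orP; right.
  by rewrite (leq_trans (leq_subr _ _)) // -ltnS prednK ?q_gt0.
split=> [p_eq0 i le_ik odd_ki | pi_eq0 a]; last first.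
  rewrite pE /p big1 ?horner0 // => i _.
  rewrite /c; case: (boolP (odd 'C(k, i))) => [odd_ki | ].
    by rewrite pi_eq0 ?leq_ord // mulr0 scale0r.
  by rewrite -natr_even => /eqP->; rewrite mul0r scale0r.
have p0 : p = 0.
  apply: (@roots_geq_poly_eq0 _ _ (enum K)); rewrite ?enum_uniq -?cardE //.
  by apply/allP=> a _; rewrite rootE -pE p_eq0.
have := coefp (Ordinal (le_ik : (i < k.+1)%N)).
rewrite p0 coef0 /c /= => /esym/eqP; rewrite mulf_eq0 natr_even odd_ki.
by move/eqP.
Qed.

(** Raising [y ^+ (i * q + (k - i))] to the power [q] exchanges [i] and [k - i],
    because [y ^+ q ^ 2 = y]. *)
Lemma power_sum_conj H k i : (i <= k)%N ->
  power_sum ((k - i) * q + k - (k - i)) H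
    = conjq q (power_sum (i * q + k - i) H).
Proof.
move=> le_ik; rewrite /power_sum (big_morph _ conjqD conjq0).
apply: eq_bigr => y _; rewrite /conjq -addnBA ?leq_subr // subKn //.
rewrite -addnBA // !exprD exprMn -!exprM mulrC; congr (_ * _).
by rewrite -mulnA mulnn -card_K mulnC exprM expf_card.
Qed.

(** The middle index [k = i.*2], which the half range omits, does not occur: the
    central binomial coefficient is even. *)
Lemma half_range_iff H k : (1 <= k)%N ->
  (forall i, (i <= k)%N -> odd 'C(k, i) -> power_sum (i * q + k - i) H = 0) <->
  (forall i, (i <= (k - 1) %/ 2)%N -> digit_le i k ->
    power_sum (i * q + k - i) H = 0).
Proof.
move=> k_gt0; have halfE i : (i <= (k - 1) %/ 2)%N = (i.*2 < k)%N.
  by rewrite leq_divRL // muln2 leq_subRL // add1n.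
split=> [full i | half i le_ik odd_ki].
  rewrite halfE -addnn => lt_ik /odd_binP; apply: full.
  by rewrite ltnW // (leq_ltn_trans (leq_addr _ _) lt_ik).
have [lt_ik|le_ki] := ltnP i.*2 k.
  by apply: half; rewrite ?halfE //; apply/odd_binP.
move: le_ki; rewrite leq_eqVlt => /predU1P[Dk|lt_ki].
  by rewrite Dk odd_central_bin in odd_ki; move: k_gt0; rewrite Dk double_gt0.
apply: (can_inj conjqK); rewrite -power_sum_conj // half ?conjq0 //.
- by rewrite halfE doubleB ltn_subLR ?leq_double // -addnn ltn_add2r.
- by apply/odd_binP; rewrite bin_sub.
Qed.

End QuadraticExtension.

Theorem theorem2 (m q t : nat) (K : finFieldType)
    (m_ge1 : (1 <= m)%N) (def_q : q = (2 ^ m)%N) (card_K : #|K| = (q ^ 2)%N)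
    (t_ge2 : (2 <= t)%N) (H : {set K}) (star_H : is_star_set q t H) :
  (is_KM_arc q t (affine_set q H) /\
   is_nucleus q t (affine_set q H) (affine_point q 0))
  <-> (forall d : nat, exponent_set q d -> power_sum d H = 0).
Proof.
have evenH : ~~ odd #|H|.
  have [-> _ _] := star_H; rewrite oddD negb_add.
  rewrite (negPf (q_even m_ge1 def_q)).
  by rewrite (negPf (star_mult_even def_q t_ge2 star_H)).
rewrite (KM_arc_iff_even m_ge1 def_q card_K t_ge2 star_H).
rewrite (even_sections_iff_forms m_ge1 def_q card_K evenH); last first.
  exact: (star_radial_even m_ge1 def_q card_K t_ge2 star_H).
have lt_kq k : (1 <= k <= q - 2)%N -> (k < q)%N.
  case/andP=> _ /leq_ltn_trans; apply; rewrite ltn_subrL.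
  by rewrite (q_gt0 m_ge1 def_q).
split=> [forms d [k [i [k_bnd le_i le_ik ->]]] | sums k a k_bnd].
  have [k_gt0 _] := andP k_bnd.
  move: i le_i le_ik; apply/(half_range_iff m_ge1 def_q card_K H k_gt0).
  apply/(forms_eq0_iff m_ge1 def_q card_K H (lt_kq k k_bnd)) => a.
  exact: forms.
have [k_gt0 _] := andP k_bnd.
apply: (proj2 (forms_eq0_iff m_ge1 def_q card_K H (lt_kq k k_bnd))) => {a}.
apply/(half_range_iff m_ge1 def_q card_K H k_gt0) => i le_i le_ik.
by apply: sums; exists k, i.
Qed.
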